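(* Let $L$ be a nice Laurent polynomial in $D$ variables with $\ell(L)=m$, and let $\mu$ be a complex Borel measure on $\mathbb{T}^D$ such that both $\mu$ and $L\,d\mu$ are quasi-definite. Then a set of nodes $\mathcal N_{k,m}=\{p_1,\dots,p_{r_{k,m}}\}\subset Z(L)$ is poised if and only if the Laurent–Vandermonde matrix $\mathcal V_k^m$ has full column rank.
   Context: Let $D\ge1$, $z(\theta)=(e^{i\theta_1},\dots,e^{i\theta_D})$. For $\alpha\in\mathbb{Z}^D$ put $|\alpha|=\sum_a|\alpha_a|$, $z^\alpha=\prod_a z_a^{\alpha_a}$, $[k]=\{\alpha:|\alpha|=k\}$ with cardinality $|[k]|$, $N_k=\sum_{l=0}^k|[l]|$. Multi-indices are ordered by $|\alpha|$ and lexicographically inside each $[k]$; $\chi(z)$ is the semi-infinite column of all monomials in this order and $\chi^{[k]}(z)$ its part with $|\alpha|<k$. Semi-infinite matrices have the corresponding block structure; $A^{[k]}$ denotes truncation to blocks $0,\dots,k-1$. The moment matrix is $G=\oint_{\mathbb{T}^D}\chi(z(\theta))d\mu(\theta)\chi(z(\theta))^\dagger$; $\mu$ is quasi-definite if $\det G^{[k]}\ne0$ for all $k\ge1$, and then uniquely $G=S^{-1}H(\hat S^{-1})^\dagger$ with $S,\hat S$ block lower unitriangular, $H$ block diagonal. $\Phi=S\chi$ has blocks $\phi_{[k]}$. For $L=\sum L_\alpha z^\alpha\neq 0$, $\ell(L)=\max\{|\alpha|:L_\alpha\neq0\}$, $Z(L)=\{p\in(\mathbb{C}^* )^D:L(p)=0\}$;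 $L$ is nice if $\ell(LM)=\ell(L)+\ell(M)$ for every nonzero Laurent polynomial $M$. Let $r_{k,m}=|[k]|+\cdots+|[k+m-1]|$. The nodes are poised if $\det\Sigma_k^m\neq0$, where $\Sigma_k^m\in\mathbb{C}^{r_{k,m}\times r_{k,m}}$ is the sample matrix whose $j$-th column is $(\phi_{[k]}(p_j);\dots;\phi_{[k+m-1]}(p_j))$. The Laurent–Vandermonde matrix is $\mathcal V_k^m=\big(\chi^{[k+m]}(p_1),\dots,\chi^{[k+m]}(p_{r_{k,m}})\big)\in\mathbb{C}^{N_{k+m-1}\times r_{k,m}}$. *)

(* Defs.v *)
From HB Require Import structures.
From mathcomp Require Import all_boot all_order all_algebra finmap complex.
From mathcomp Require Import all_classical all_reals all_analysis.
From mathcomp Require Import zify.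

Set Implicit Arguments.
Unset Strict Implicit.
Unset Printing Implicit Defensive.

Import Order.TTheory GRing.Theory Num.Theory.
Import numFieldNormedType.Exports.

Local Open Scope ring_scope.

(* The field of complex numbers R[i], with the structure that carries its
   norm topology. *)
Definition Cx (R : realType) : numClosedFieldType := R[i].

(* T^D as a subset of C^D: the points (e^(i theta_1), ..., e^(i theta_D)). *)
Definition torus_set (R : realType) (D : nat) : set 'rV[Cx R]_D :=
  [set z | forall a, `|z 0 a| = 1]%classic.
Arguments torus_set R D : clear implicits.

Lemma torus_set1 (R : realType) (D : nat) : torus_set R D (const_mx 1).
Proof. by move=> a; rewrite mxE normr1. Qed.

(* T^D as a space, with the topology induced by C^D. *)
Definition torus (R : realType) (D : nat) : Type := set_type (torus_set R D).

HB.instance Definition _ R D := Choice.on (torus R D).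
HB.instance Definition _ R D := Topological.on (torus R D).
HB.instance Definition _ R D :=
  isPointed.Build (torus R D) (exist _ (const_mx 1) (mem_set (@torus_set1 R D))).

Definition torus_val (R : realType) (D : nat) (z : torus R D) : 'rV[Cx R]_D :=
  set_val z.

(* A charge with values in \bar C only takes finite values on measurable sets
   and is sigma-additive: it is a complex measure, here on the Borel
   sigma-algebra of the torus. *)
Definition complex_measure (R : realType) (D : nat) : Type :=
  {charge set (g_sigma_algebraType (@open (torus R D))) -> \bar (Cx R)}.

Section ReIm_charge.
Context d (T : measurableType d) (R : realType).
Implicit Types nu : {charge set T -> \bar (Cx R)}.

Lemma normC_ge_absRe (z : Cx R) : (`|complex.Re z|)%:C%C <= `|z|.
Proof.
case: z => x y; rewrite normc_def lecR/= -sqrtr_sqr ler_sqrt ?lerDl ?sqr_ge0//.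
by rewrite addr_ge0 ?sqr_ge0.
Qed.

Lemma normC_ge_absIm (z : Cx R) : (`|complex.Im z|)%:C%C <= `|z|.
Proof.
case: z => x y; rewrite normc_def lecR/= -sqrtr_sqr ler_sqrt ?lerDr ?sqr_ge0//.
by rewrite addr_ge0 ?sqr_ge0.
Qed.

Lemma cvg_part (g : Cx R -> R) (u : nat -> Cx R) (l : Cx R) :
  {morph g : x y / x - y} -> (forall z, (`|g z|)%:C%C <= `|z|) ->
  (u n @[n --> \oo] --> l)%classic -> (g (u n) @[n --> \oo] --> g l)%classic.
Proof.
move=> gB gle /cvgrPdist_lt ul; apply/cvgrPdist_lt => e e0.
have e0' : 0 < e%:C%C :> Cx R by rewrite ltcR.
near=> n; rewrite -gB -ltcR; apply: le_lt_trans (gle _) _.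
by near: n; exact: ul.
Unshelve. all: by end_near. Qed.

Lemma part_semi_sigma_additive (g : Cx R -> R) nu :
  {morph g : x y / x + y} -> {morph g : x y / x - y} -> g 0 = 0 ->
  (forall z, (`|g z|)%:C%C <= `|z|) ->
  semi_sigma_additive (fun A : set T => (g (fine (nu A)))%:E).
Proof.
move=> gD gB g0 gle F mF tF mUF.
have := @charge_semi_sigma_additive _ _ _ nu F mF tF mUF.
rewrite -[X in (_ --> X)%classic](@fineK _ (nu (\bigcup_n F n)%classic)); last exact: fin_num_measure.
move=> /fine_cvg /(cvg_part gB gle) h.
apply: cvg_EFin; first by near=> n; rewrite sumEFin.
apply: cvg_trans h; apply: near_eq_cvg; near=> n => /=.
rewrite sumEFin/=.
have -> : (\sum_(0 <= i < n) nu (F i))%E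
        = (\sum_(0 <= i < n) fine (nu (F i)))%:E.
  by rewrite -sumEFin; apply: eq_bigr => i _; rewrite fineK// fin_num_measure.
by rewrite /= (big_morph g gD g0).
Unshelve. all: by end_near. Qed.

Definition charge_Re nu : set T -> \bar R :=
  fun A => (complex.Re (fine (nu A)))%:E.

Definition charge_Im nu : set T -> \bar R :=
  fun A => (complex.Im (fine (nu A)))%:E.

Let charge_Re0 nu : charge_Re nu set0 = 0%E.
Proof. by rewrite /charge_Re charge0. Qed.

Let charge_Re_fin nu A : measurable A -> charge_Re nu A \is a fin_num.
Proof. by []. Qed.

Let charge_Re_sigma nu : semi_sigma_additive (charge_Re nu).
Proof.
apply: (@part_semi_sigma_additive (@complex.Re R)) => //; last exact: normC_ge_absRe.
- by case=> a b [].
- by case=> a b [].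
Qed.

HB.instance Definition _ nu := isCharge.Build _ _ _ (charge_Re nu)
  (charge_Re0 nu) (@charge_Re_fin nu) (@charge_Re_sigma nu).

Let charge_Im0 nu : charge_Im nu set0 = 0%E.
Proof. by rewrite /charge_Im charge0. Qed.

Let charge_Im_fin nu A : measurable A -> charge_Im nu A \is a fin_num.
Proof. by []. Qed.

Let charge_Im_sigma nu : semi_sigma_additive (charge_Im nu).
Proof.
apply: (@part_semi_sigma_additive (@complex.Im R)) => //; last exact: normC_ge_absIm.
- by case=> a b [].
- by case=> a b [].
Qed.

HB.instance Definition _ nu := isCharge.Build _ _ _ (charge_Im nu)
  (charge_Im0 nu) (@charge_Im_fin nu) (@charge_Im_sigma nu).

End ReIm_charge.

Section complex_integral.
Context d (T : measurableType d) (R : realType).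

Lemma hahn_exists (nu : {charge set T -> \bar R}) :
  {PN : set T * set T | hahn_decomposition nu PN.1 PN.2}.
Proof.
apply: cid; have [P [N PN]] := Hahn_decomposition nu.
by exists (P, N).
Qed.

(* Integral of a bounded measurable function against a finite signed measure,
   by Jordan decomposition; the positive and negative parts do not depend on
   the Hahn decomposition (Hahn_decomposition_uniq). *)
Definition charge_integral (nu : {charge set T -> \bar R}) (f : T -> R) : R :=
  let nuPN := svalP (hahn_exists nu) in
  Rintegral (jordan_pos nuPN) setT f - Rintegral (jordan_neg nuPN) setT f.

(* int f dmu = int (Re f + i Im f) d(Re mu + i Im mu) *)
Definition complex_integral (mu : {charge set T -> \bar (Cx R)})
    (f : T -> Cx R) : Cx R :=
  let re z := complex.Re (f z) in
  let im z := complex.Im (f z) in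
  Complex
    (charge_integral (charge_Re mu) re - charge_integral (charge_Im mu) im)
    (charge_integral (charge_Re mu) im + charge_integral (charge_Im mu) re).

End complex_integral.

Section multi_indices.
Variable D : nat.
Implicit Types alpha beta : 'rV[int]_D.

Definition mnorm alpha : nat := (\sum_a `|alpha 0%R a|)%N.

Definition mlex : rel 'rV[int]_D := fun alpha beta =>
  (([seq alpha 0 a | a : 'I_D] : seqlexi int) <= [seq beta 0 a | a : 'I_D])%O.

(* The multi-indices of [k], in lexicographic order: they are picked among
   those with all entries in {-k, ..., k}. *)
Definition shell (k : nat) : seq 'rV[int]_D :=
  sort mlex
    [seq alpha <- [seq (\row_a ((f a : nat)%:Z - k%:Z)) |
                     f : {ffun 'I_D -> 'I_(k.*2.+1)}] | mnorm alpha == k].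

Lemma mem_shell k alpha : (alpha \in shell k) = (mnorm alpha == k).
Proof.
rewrite mem_sort mem_filter andb_idr// => /eqP alphak.
have ak a : (`|alpha 0%R a| <= k)%N.
  by rewrite -alphak /mnorm (bigD1 a)//= leq_addr.
have h a : (`|(alpha 0 a + k%:Z)%R|%N < k.*2.+1)%N.
  by have := ak a; lia.
apply/mapP; exists [ffun a => Ordinal (h a)]; first by rewrite mem_enum.
apply/rowP => a; rewrite !mxE ffunE/= gez0_abs ?addrK//.
by have := ak a; lia.
Qed.

Lemma shell_uniq k : uniq (shell k).
Proof.
rewrite sort_uniq filter_uniq// map_inj_uniq ?enum_uniq// => f g /rowP fg.
apply/ffunP => a; apply/val_inj/eqP; rewrite -eqz_nat; apply/eqP.
by move: (fg a); rewrite !mxE => /addIr.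
Qed.

Lemma shell_sorted k : sorted mlex (shell k).
Proof. by apply: sort_sorted => alpha beta; exact: le_total. Qed.

(* |[k]| *)
Definition bsize (k : nat) : nat := size (shell k).

End multi_indices.

Definition mono (R : realType) (D : nat) (z : 'rV[Cx R]_D) (alpha : 'rV[int]_D)
  : Cx R := \prod_a z 0 a ^ alpha 0 a.

(* The block of chi(z) that consists of the monomials in [k]. *)
Definition chi (R : realType) (D k : nat) (z : 'rV[Cx R]_D)
  : 'cV[Cx R]_(bsize D k) := \col_i mono z (shell D k)`_i.

Section semi_infinite.
Variables (R : realType) (D : nat).

(* A semi-infinite matrix, given by its blocks. *)
Definition simatrix : Type :=
  forall k l : nat, 'M[Cx R]_(bsize D k, bsize D l).

Implicit Types A B G S H : simatrix.

(* A^[k], of size N_(k-1) = |[0]| + ... + |[k-1]| *)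
Definition trunc A (k : nat) : 'M[Cx R]_(\sum_(i < k) bsize D i) :=
  \mxblock_(i < k, j < k) A i j.

Definition block_lower A : Prop := forall k l, (k < l)%N -> A k l = 0.

Definition block_lower_unitriangular A : Prop :=
  block_lower A /\ forall k, A k k = 1%:M.

Definition block_diagonal A : Prop := forall k l, k <> l -> A k l = 0.

(* The product A B for A block lower triangular: A k j = 0 for j > k, so the
   sum over all j reduces to j <= k. *)
Definition simul A B : simatrix := fun k l => \sum_(j < k.+1) A k j *m B j l.

Definition siadj A : simatrix := fun k l => ((A l k) ^t*)%sesqui.

Definition si1 : simatrix :=
  fun k l => \matrix_(i, j) ((k == l) && (i == j :> nat))%:R.

(* T = S^{-1}, for S block lower unitriangular *)
Definition siinverse S (T : simatrix) : Prop :=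
  [/\ block_lower_unitriangular T,
      forall k l, simul T S k l = si1 k l
    & forall k l, simul S T k l = si1 k l].

(* G = S^{-1} H (Sh^{-1})^dagger with S, Sh block lower unitriangular and H
   block diagonal; T and Th are the inverses of S and Sh. *)
Definition gauss_borel G S H (Sh : simatrix) : Prop :=
  [/\ block_lower_unitriangular S, block_lower_unitriangular Sh,
      block_diagonal H
    & exists T Th : simatrix,
        [/\ siinverse S T, siinverse Sh Th
          & forall k l, G k l = simul T (simul H (siadj Th)) k l]].

(* The moment matrix of the measure w dmu: w = 1 gives mu itself, and w = L the
   measure L dmu. *)
Definition moment_matrix (mu : complex_measure R D) (w : 'rV[Cx R]_D -> Cx R)
  : simatrix := fun k l => \matrix_(i, j)
    complex_integral mu (fun z => let x := torus_val z in
      (chi k x *m ((chi l x) ^t*)%sesqui) i j * w x).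

Definition quasi_definite (mu : complex_measure R D)
    (w : 'rV[Cx R]_D -> Cx R) : Prop :=
  forall k, (1 <= k)%N -> \det (trunc (moment_matrix mu w) k) != 0.

(* The block phi_[k] of Phi = S chi, for S block lower triangular. *)
Definition phi S (k : nat) (z : 'rV[Cx R]_D) : 'cV[Cx R]_(bsize D k) :=
  \sum_(l < k.+1) S k l *m chi l z.

End semi_infinite.

(* alpha |-> L_alpha, with finite support *)
Definition laurent (R : realType) (D : nat) : Type :=
  {fsfun 'rV[int]_D -> Cx R with 0}.

Section laurent.
Variables (R : realType) (D : nat).
Implicit Types L M : laurent R D.

Definition laurent0 : laurent R D := [fsfun].

Definition leval L (z : 'rV[Cx R]_D) : Cx R :=
  \sum_(alpha <- finsupp L) L alpha * mono z alpha.

Definition ell L : nat := (\max_(alpha <- finsupp L) mnorm alpha)%N.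

Definition lmul L M : laurent R D :=
  [fsfun gamma in [fset (alpha + beta)%R | alpha in finsupp L,
                                           beta in finsupp M]%fset =>
    \sum_(alpha <- finsupp L) L alpha * M (gamma - alpha)].

Lemma lmulE L M gamma :
  lmul L M gamma = \sum_(alpha <- finsupp L) L alpha * M (gamma - alpha).
Proof.
rewrite fsfunE; case: ifPn => // /negP h; apply/esym; rewrite big_seq big1//.
move=> alpha aL; rewrite (fsfun_dflt (f := M)) ?mulr0//; apply/negP => bM.
apply: h; apply/imfset2P; exists alpha => //; exists (gamma - alpha) => //.
by rewrite addrC subrK.
Qed.

Definition nice L : Prop :=
  L <> laurent0 /\
  forall M, M <> laurent0 -> ell (lmul L M) = (ell L + ell M)%N.

(* Z(L), inside (C^* )^D *)
Definition zero_set L : set 'rV[Cx R]_D :=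
  [set p : 'rV[Cx R]_D | (forall a, p 0 a != 0) /\ leval L p = 0]%classic.

End laurent.

(* r_(k,m) *)
Definition rsize (D k m : nat) : nat := (\sum_(l < m) bsize D (k + l))%N.

Section nodes.
Variables (R : realType) (D k m : nat).
Variable p : 'I_(rsize D k m) -> 'rV[Cx R]_D.

Definition sample_matrix (S : simatrix R D) : 'M[Cx R]_(rsize D k m) :=
  \matrix_(i, j) (\mxcol_(l < m) phi S (k + l) (p j)) i 0.

Definition poised (S : simatrix R D) : Prop := \det (sample_matrix S) != 0.

Definition laurent_vandermonde
    : 'M[Cx R]_(\sum_(l < k + m) bsize D l, rsize D k m) :=
  \matrix_(i, j) (\mxcol_(l < k + m) chi l (p j)) i 0.

End nodes.

(* Main.v *)
(* If the Vandermonde matrix kills a column c, then so does the sample matrix,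
   because Phi = S chi.  Conversely, let the sample matrix kill c, and let Lam be
   the functional f |-> sum_j c_j f(p_j); it kills phi_[l] for k <= l < k + m, and
   it kills z^alpha L since the nodes lie in Z(L).  As G^[k] is invertible, Lam
   agrees on the monomials with |alpha| < k with f |-> int f conj(w) dmu for some
   w in their span.  By biorthogonality this functional kills phi_[l] for l >= k,
   so the agreement extends to |alpha| < k + m.  Evaluating on z^alpha L with
   |alpha| < k shows that w is in the kernel of the k-th truncated moment matrix
   of L dmu, hence w = 0, Lam vanishes for |alpha| < k + m, and c is in the kernel
   of the Vandermonde matrix. *)

Require Import Defs.
From mathcomp Require Import all_boot all_order all_algebra finmap complex.
From mathcomp Require Import all_classical all_reals all_analysis.
From mathcomp Require Import measurable_realfun ring zify.

Set Implicit Arguments.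
Unset Strict Implicit.
Unset Printing Implicit Defensive.

Import Order.TTheory GRing.Theory Num.Theory.
Import numFieldNormedType.Exports.

(** * Linearity of the integral against a complex measure *)

Section integral_linear.
Local Open Scope ring_scope.
Local Open Scope classical_set_scope.
Context {d} {T : measurableType d} {R : realType}.
Implicit Types (nu : {charge set T -> \bar R}) (f g : T -> R).

(** The Jordan parts of a charge are finite measures, so this condition, which mentions no measure,
    gives integrability against both of them. *)
Definition bounded_mfun f :=
  measurable_fun setT f /\ exists M, forall x, `|f x| <= M.

Lemma bounded_mfun_integrable (nu : {finite_measure set T -> \bar R}) f :
  bounded_mfun f -> nu.-integrable setT (EFin \o f).
Proof.
move=> [mf [M fM]]; apply: measurable_bounded_integrable => //.
  by rewrite ltey_eq fin_num_measure.
exists M; split; first by rewrite num_real.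
by move=> N MN x _ /=; exact: le_trans (fM x) (ltW MN).
Qed.

Lemma bounded_mfunD f g :
  bounded_mfun f -> bounded_mfun g -> bounded_mfun (fun x => f x + g x).
Proof.
move=> [mf [M fM]] [mg [N gN]]; split; first exact: measurable_funD.
exists (M + N) => x; apply: le_trans (ler_normD _ _) _.
by rewrite lerD.
Qed.

Lemma bounded_mfunZ a f : bounded_mfun f -> bounded_mfun (fun x => a * f x).
Proof.
move=> [mf [M fM]]; split; first exact: measurable_funM.
by exists (`|a| * M) => x; rewrite normrM ler_wpM2l.
Qed.

Lemma charge_integralD nu f g : bounded_mfun f -> bounded_mfun g ->
  charge_integral nu (fun x => f x + g x) =
  charge_integral nu f + charge_integral nu g.
Proof.
move=> bf bg; rewrite /charge_integral !RintegralD//; first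
  by rewrite opprD addrACA.
all: exact: bounded_mfun_integrable.
Qed.

Lemma charge_integralZ nu a f : bounded_mfun f ->
  charge_integral nu (fun x => a * f x) = a * charge_integral nu f.
Proof.
move=> bf; rewrite /charge_integral !RintegralZl//; first by rewrite mulrBr.
all: exact: bounded_mfun_integrable.
Qed.

Definition bounded_cmfun (f : T -> Cx R) :=
  bounded_mfun (fun x => complex.Re (f x)) /\
  bounded_mfun (fun x => complex.Im (f x)).

Lemma bounded_cmfunD (f g : T -> Cx R) :
  bounded_cmfun f -> bounded_cmfun g -> bounded_cmfun (fun x => f x + g x).
Proof.
move=> [fr fi] [gr gi]; split.
- have := bounded_mfunD fr gr; congr bounded_mfun.
  by apply/funext => x; case: (f x) (g x) => ? ? [].
- have := bounded_mfunD fi gi; congr bounded_mfun.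
  by apply/funext => x; case: (f x) (g x) => ? ? [].
Qed.

(** The minus sign is attached to the scalar, which makes the right-hand side a sum of real
    multiples, the form that [bounded_mfunD] and [charge_integralD] take. *)
Lemma Re_mulE (a z : Cx R) :
  complex.Re (a * z) = complex.Re a * complex.Re z + - complex.Im a * complex.Im z.
Proof. by case: a z => ? ? [? ?] /=; rewrite mulNr. Qed.

Lemma Im_mulE (a z : Cx R) :
  complex.Im (a * z) = complex.Re a * complex.Im z + complex.Im a * complex.Re z.
Proof. by case: a z => ? ? [? ?]. Qed.

Lemma bounded_cmfunZ a (f : T -> Cx R) :
  bounded_cmfun f -> bounded_cmfun (fun x => a * f x).
Proof.
move=> [fr fi]; split.
- under eq_fun do rewrite Re_mulE.
  by apply: bounded_mfunD; exact: bounded_mfunZ.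
- under eq_fun do rewrite Im_mulE.
  by apply: bounded_mfunD; exact: bounded_mfunZ.
Qed.

Lemma complex_integralD (mu : {charge set T -> \bar (Cx R)}) (f g : T -> Cx R) :
  bounded_cmfun f -> bounded_cmfun g ->
  complex_integral mu (fun x => f x + g x) =
  complex_integral mu f + complex_integral mu g.
Proof.
move=> [fr fi] [gr gi]; rewrite /complex_integral.
have -> : (fun x => complex.Re (f x + g x)) =
          (fun x => complex.Re (f x) + complex.Re (g x)).
  by apply/funext => x; case: (f x) (g x) => ? ? [].
have -> : (fun x => complex.Im (f x + g x)) =
          (fun x => complex.Im (f x) + complex.Im (g x)).
  by apply/funext => x; case: (f x) (g x) => ? ? [].
rewrite !charge_integralD//; apply/eqP; rewrite eq_complex/=.
by rewrite opprD addrACA eqxx addrACA eqxx.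
Qed.

Lemma complex_integralZ (mu : {charge set T -> \bar (Cx R)}) a (f : T -> Cx R) :
  bounded_cmfun f ->
  complex_integral mu (fun x => a * f x) = a * complex_integral mu f.
Proof.
move=> [fr fi]; rewrite /complex_integral.
under [fun x => complex.Re _]eq_fun do rewrite Re_mulE.
under [fun x => complex.Im _]eq_fun do rewrite Im_mulE.
have bZ := bounded_mfunZ.
rewrite !charge_integralD; try exact: bZ; rewrite ?charge_integralZ //.
case: a => a b; apply/eqP; rewrite eq_complex/=.
by apply/andP; split; apply/eqP; ring.
Qed.

Lemma bounded_cmfun_sum (I : Type) (r : seq I) (c : I -> Cx R)
    (f : I -> T -> Cx R) : (forall i, bounded_cmfun (f i)) ->
  bounded_cmfun (fun x => \sum_(i <- r) c i * f i x).
Proof.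
move=> bf; elim: r => [|i r IH].
  under eq_fun do rewrite big_nil.
  by split; split; [exact: measurable_cst|exists 0 => _; rewrite normr0|
    exact: measurable_cst|exists 0 => _; rewrite normr0].
under eq_fun do rewrite big_cons.
by apply: bounded_cmfunD => //; exact: bounded_cmfunZ.
Qed.

Lemma complex_integral_sum (mu : {charge set T -> \bar (Cx R)}) (I : Type)
    (r : seq I) (c : I -> Cx R) (f : I -> T -> Cx R) :
  (forall i, bounded_cmfun (f i)) ->
  complex_integral mu (fun x => \sum_(i <- r) c i * f i x) =
  \sum_(i <- r) c i * complex_integral mu (f i).
Proof.
move=> bf; elim: r => [|i r IH].
  have f0 : bounded_cmfun (fun=> 0 : Cx R).
    by have := @bounded_cmfun_sum I [::] c f bf; under eq_fun do rewrite big_nil.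
  (* The integral of the zero function is 0 by homogeneity with factor 0. *)
  rewrite big_nil -[RHS](mul0r (complex_integral mu (fun=> 0))).
  rewrite -complex_integralZ//.
  by congr complex_integral; apply/funext => x; rewrite big_nil mul0r.
under eq_fun do rewrite big_cons.
rewrite complex_integralD ?complex_integralZ ?IH ?big_cons//.
  exact: bounded_cmfunZ (bf i).
exact: bounded_cmfun_sum.
Qed.

End integral_linear.

(** * Continuity of Laurent monomials and of real and imaginary parts *)

Section continuity.
Local Open Scope ring_scope.
Local Open Scope classical_set_scope.

Lemma continuous_mul (T : topologicalType) (K : numFieldType) (f g : T -> K) :
  continuous f -> continuous g -> continuous (fun z => f z * g z).
Proof. by move=> cf cg z; apply: cvgM; [exact: cf|exact: cg]. Qed.

Lemma continuous_prod_expz (T : topologicalType) (K : numFieldType) (D : nat)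
    (x : 'I_D -> T -> K) (n : 'I_D -> int) :
  (forall a, continuous (x a)) -> (forall a z, x a z != 0) ->
  continuous (fun z => \prod_a x a z ^ n a).
Proof.
move=> cx x0.
have cX a k : continuous (fun z => x a z ^+ k).
  elim: k => [|k IH]; first exact: cst_continuous.
  have -> : (fun z => x a z ^+ k.+1) = (fun z => x a z * x a z ^+ k).
    by apply/funext => z; rewrite exprS.
  exact: continuous_mul.
elim: (index_enum _) => [|a r IH].
  rewrite (_ : (fun z => _) = fun=> 1); first exact: cst_continuous.
  by apply/funext => z; rewrite big_nil.
rewrite (_ : (fun z => _) = fun z => x a z ^ n a * \prod_(b <- r) x b z ^ n b);
  last by apply/funext => z; rewrite big_cons.
apply: continuous_mul IH.
(* A negative exponent gives the inverse of a positive power, continuous because [x a] never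
   vanishes. *)
case: (n a) => k; first exact: cX.
by move=> z; apply: cvgV; [rewrite expf_neq0|exact: cX].
Qed.

Lemma continuous_part (T : topologicalType) (R : realType) (g : Cx R -> R)
    (f : T -> Cx R) :
  {morph g : x y / x - y} -> (forall z, (`|g z|)%:C%C <= `|z|) ->
  continuous f -> continuous (fun z => g (f z)).
Proof.
move=> gB gle cf z; apply/cvgrPdist_lt => e e0.
have e0' : 0 < e%:C%C :> Cx R by rewrite ltcR.
near=> y; rewrite -gB -ltcR; apply: le_lt_trans (gle _) _.
by near: y; move/cvgrPdist_lt: (cf z); apply.
Unshelve. all: by end_near. Qed.

End continuity.

(** * Monomials on the torus and the entries of the moment matrices *)

Section monomials_on_torus.
Local Open Scope ring_scope.
Local Open Scope classical_set_scope.
Variables (R : realType) (D : nat).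
Implicit Types (alpha beta : 'rV[int]_D) (z : torus R D).

Lemma torus_norm z a : `|torus_val z 0 a| = 1.
Proof. by case: z => x xT; exact: (set_mem xT a). Qed.

Lemma torus_neq0 z a : torus_val z 0 a != 0.
Proof. by rewrite -normr_eq0 torus_norm oner_neq0. Qed.

Lemma monoD (x : 'rV[Cx R]_D) alpha beta : (forall a, x 0 a != 0) ->
  mono x (alpha + beta) = mono x alpha * mono x beta.
Proof.
move=> x0; rewrite /mono -big_split/=; apply: eq_bigr => a _.
by rewrite mxE expfzDr.
Qed.

(** On the torus every coordinate has modulus 1, so conjugation is inversion. Hence each entry of
    chi chi^dagger is a single monomial. *)
Lemma conj_mono z beta : (mono (torus_val z) beta)^* = mono (torus_val z) (- beta).
Proof.
rewrite /mono rmorph_prod; apply: eq_bigr => a _.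
have zV : (torus_val z 0 a)^* = (torus_val z 0 a)^-1.
  by rewrite invC_norm torus_norm expr1n invr1 mul1r.
by rewrite mxE -exprz_inv -zV; case: (beta 0 a) => n; rewrite ?fmorphV rmorphXn.
Qed.

Lemma norm_mono z alpha : `|mono (torus_val z) alpha| = 1.
Proof.
rewrite /mono normr_prod big1// => a _.
by case: (alpha 0 a) => n; rewrite ?normfV normrX torus_norm expr1n ?invr1.
Qed.

Lemma continuous_mono alpha :
  continuous (fun z => mono (torus_val z) alpha : Cx R).
Proof.
apply: (@continuous_prod_expz (torus R D) (Cx R) D (fun a z => torus_val z 0 a)
  (fun a => alpha 0 a)) => a z; last exact: torus_neq0.
apply: (@continuous_comp _ _ _ (@torus_val R D) (fun x : 'rV[Cx R]_D => x 0 a)).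
  exact: initial_continuous.
exact: coord_continuous.
Qed.

Lemma part_bounded_mfun (g : Cx R -> R) (f : torus R D -> Cx R) :
  {morph g : x y / x - y} -> (forall w, (`|g w|)%:C%C <= `|w|) ->
  continuous f -> (forall z, `|f z| = 1) ->
  bounded_mfun (fun z : g_sigma_algebraType (@open (torus R D)) => g (f z)).
Proof.
move=> gB gle cf f1; split; last first.
  by exists 1 => z; rewrite -lecR (le_trans (gle _))// f1.
have cg : continuous (fun z => g (f z)) by exact: continuous_part.
(* Open intervals generate the Borel sets of the line, and their preimages under a continuous map
   are open. *)
apply: (measurability _ (RGenOpens.measurableE R)).
move=> _ [_ [a [b ->] <-]]; rewrite setTI; apply: sub_sigma_algebra.
by move/continuousP: cg; apply; exact: interval_open.
Qed.

Lemma bounded_cmfun_mono alpha :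
  bounded_cmfun (fun z : g_sigma_algebraType (@open (torus R D)) =>
    mono (torus_val z) alpha).
Proof.
split.
- apply: (@part_bounded_mfun (@complex.Re R)).
  + by case=> ? ? [].
  + exact: normC_ge_absRe.
  + exact: continuous_mono.
  + by move=> z; exact: norm_mono.
- apply: (@part_bounded_mfun (@complex.Im R)).
  + by case=> ? ? [].
  + exact: normC_ge_absIm.
  + exact: continuous_mono.
  + by move=> z; exact: norm_mono.
Qed.

(** The Fourier coefficients of [mu]: the entries of its moment matrix depend only on differences of
    multi-indices, a multivariate Toeplitz structure. *)
Definition moment (mu : complex_measure R D) (gamma : 'rV[int]_D) : Cx R :=
  complex_integral mu (fun z => mono (torus_val z) gamma).

Lemma chi_adj_mono z k l i j :
  (chi k (torus_val z) *m ((chi l (torus_val z)) ^t*)%sesqui) i j =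
  mono (torus_val z) ((shell D k)`_i - (shell D l)`_j).
Proof.
rewrite mxE big_ord1 !mxE monoD; last exact: torus_neq0.
by rewrite -conj_mono.
Qed.

Lemma moment_matrix1E mu k l i j : moment_matrix mu (fun=> 1) k l i j =
  moment mu ((shell D k)`_i - (shell D l)`_j).
Proof.
rewrite mxE; congr complex_integral; apply/funext => z.
by rewrite /= chi_adj_mono mulr1.
Qed.

Lemma moment_matrix_levalE mu (L : laurent R D) k l i j :
  moment_matrix mu (leval L) k l i j = \sum_(gamma <- finsupp L)
    L gamma * moment mu ((shell D k)`_i + gamma - (shell D l)`_j).
Proof.
rewrite mxE; transitivity (complex_integral mu (fun z => \sum_(gamma <- finsupp L)
    L gamma * mono (torus_val z) ((shell D k)`_i + gamma - (shell D l)`_j))).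
  congr complex_integral; apply/funext => z.
  rewrite /= chi_adj_mono /leval mulr_sumr; apply: eq_bigr => gamma _.
  by rewrite (addrAC (shell D k)`_i) (monoD _ gamma (torus_neq0 z)) mulrCA.
apply: complex_integral_sum => gamma; exact: bounded_cmfun_mono.
Qed.

End monomials_on_torus.

(** * Kernels of matrices, truncations and the Gauss-Borel factorization *)

Section kernels.
Local Open Scope ring_scope.

(** With [det_neq0_kerP], this turns both sides of the theorem into the triviality of a kernel in
    the same space of column vectors. *)
Lemma mxrank_col_kerP (F : fieldType) m n (A : 'M[F]_(m, n)) :
  \rank A = n <-> (forall c : 'cV_n, A *m c = 0 -> c = 0).
Proof.
rewrite -mxrank_tr; split=> [rA c Ac|kA].
  have /row_free_inj inj : row_free A^T by rewrite /row_free rA.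
  by apply: trmx_inj; apply: (inj 1%N); rewrite trmx0 mul0mx -trmx_mul Ac trmx0.
apply/eqP; apply: inj_row_free => v vA; apply: trmx_inj; rewrite trmx0.
by apply: kA; apply: trmx_inj; rewrite trmx_mul trmxK vA trmx0.
Qed.

Lemma det_neq0_kerP (F : fieldType) n (A : 'M[F]_n) :
  \det A != 0 <-> (forall c : 'cV_n, A *m c = 0 -> c = 0).
Proof.
rewrite -mxrank_col_kerP -unitfE -[_ \is a _]unitmxE -row_free_unit /row_free.
by split=> [/eqP|->].
Qed.

Lemma mul_mxcol_cols (K : comPzRingType) r n (b : 'I_n -> nat)
    (f : forall l, 'I_r -> 'cV[K]_(b l)) (c : 'cV[K]_r) :
  (\matrix_(i, j) (\mxcol_(l < n) f l j) i 0) *m c =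
  \mxcol_(l < n) \sum_j c j 0 *: f l j.
Proof.
apply/colP => i; rewrite !mxE summxE; apply: eq_bigr => j _.
by rewrite !mxE mulrC.
Qed.

Variables (R : realType) (D : nat).
Implicit Types A S G H : simatrix R D.

Lemma trunc_mul A k (w : forall j : 'I_k, 'cV_(bsize D j)) :
  trunc A k *m \mxcol_j w j = \mxcol_(i < k) \sum_(j < k) A i j *m w j.
Proof. by rewrite /trunc mul_mxblock_mxrow. Qed.

Lemma trunc_ker A k (w : forall j : 'I_k, 'cV_(bsize D j)) :
  \det (trunc A k) != 0 ->
  (forall i : 'I_k, \sum_(j < k) A i j *m w j = 0) -> forall j, w j = 0.
Proof.
move=> /det_neq0_kerP kA Aw; apply/eq_mxcolP; rewrite mxcol0; apply: kA.
by rewrite trunc_mul -[RHS]mxcol0; apply/eq_mxcolP.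
Qed.

Lemma trunc_solve A k (y : forall j : 'I_k, 'cV_(bsize D j)) :
  \det (trunc A k) != 0 ->
  exists w : forall j : 'I_k, 'cV_(bsize D j),
    forall i : 'I_k, \sum_(j < k) A i j *m w j = y i.
Proof.
rewrite -unitfE -[_ \is a _]unitmxE => uA.
exists (submxcol (invmx (trunc A k) *m \mxcol_j y j)).
by apply/eq_mxcolP; rewrite -trunc_mul submxcolK mulKVmx.
Qed.

(** Forward substitution: once the earlier blocks of [y] vanish, row l reduces to [y l] because the
    diagonal block is the identity. *)
Lemma block_lower_unitriangular_ker S n (y : forall l, 'cV_(bsize D l)) :
  block_lower_unitriangular S ->
  (forall l, (l < n)%N -> \sum_(i < l.+1) S l i *m y i = 0) ->
  forall l, (l < n)%N -> y l = 0.
Proof.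
move=> [_ S1] Sy; elim/ltn_ind => l IH ln.
have := Sy l ln; rewrite big_ord_recr/= S1 mul1mx big1 ?add0r// => i _.
by rewrite IH ?mulmx0// (ltn_trans _ ln).
Qed.

(** [S] cancels the left factor of [G] and leaves [H] times the adjoint of the inverse of [Sh],
    which is block upper triangular. This is the orthogonality of phi_[k] to the monomials of [l]
    for l < k. *)
Lemma gauss_borel_below G S H (Sh : simatrix R D) k l :
  gauss_borel G S H Sh -> (l < k)%N -> simul S G k l = 0.
Proof.
move=> [_ _ dH [T [Th [[[lT _] _ ST] [[lTh _] _ _] GE]]]] lk.
pose X i := simul H (siadj Th) i l.
(* [T] is block lower triangular, so the sum may run up to k for every j <= k; with a range
   independent of j, the two sums can be exchanged. *)
have GX j : (j < k.+1)%N -> G j l = \sum_(i < k.+1) T j i *m X i.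
  move=> jk; rewrite GE /simul (big_ord_widen _ (fun i => T j i *m X i) jk).
  rewrite big_mkcond; apply: eq_bigr => i _; case: ltnP => // ji.
  by rewrite lT ?mul0mx.
rewrite /simul (eq_bigr (fun j : 'I_k.+1 =>
  \sum_(i < k.+1) S k j *m T j i *m X i)); last first.
  move=> j _; rewrite GX// mulmx_sumr; apply: eq_bigr => i _.
  by rewrite mulmxA.
rewrite exchange_big/= big1// => i _; rewrite -mulmx_suml.
have -> : \sum_(j < k.+1) S k j *m T j i = si1 R D k i by rewrite -ST.
have [ki|ki] := eqVneq k i; last first.
  rewrite (_ : si1 _ _ _ _ = 0) ?mul0mx//; apply/matrixP => a b.
  by rewrite !mxE (negbTE ki).
rewrite /X /simul big1 ?mulmx0// => i' _.
(* Diagonality of [H] leaves i' = i = k, where the other factor is the adjoint of [Th l k], zero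
   because l < k. *)
have [<-|/eqP ii'] := eqVneq (i : nat) i'; last by rewrite dH ?mul0mx.
by rewrite /siadj lTh -?ki// trmx0 map_mx0 mulmx0.
Qed.

End kernels.

(** * Functionals that annihilate multiples of L and the blocks of Phi *)

Section annihilator.
Local Open Scope ring_scope.
Variables (R : realType) (D : nat).
Implicit Types (alpha gamma : 'rV[int]_D).

Lemma mnormD alpha gamma : (mnorm (alpha + gamma) <= mnorm alpha + mnorm gamma)%N.
Proof.
rewrite /mnorm -big_split/=; apply: leq_sum => a _; rewrite mxE.
by move: (alpha 0 a) (gamma 0 a) => x y; lia.
Qed.

Lemma mnorm_ell (L : laurent R D) gamma :
  gamma \in finsupp L -> (mnorm gamma <= ell L)%N.
Proof. by move=> gL; rewrite /ell (leq_bigmax_seq (F := @mnorm D)). Qed.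

Lemma mnorm_shell l (i : 'I_(bsize D l)) : mnorm (shell D l)`_i = l.
Proof. by apply/eqP; rewrite -mem_shell mem_nth. Qed.

Lemma shellP alpha :
  exists i : 'I_(bsize D (mnorm alpha)), (shell D (mnorm alpha))`_i = alpha.
Proof.
have aS : alpha \in shell D (mnorm alpha) by rewrite mem_shell.
have iS : (index alpha (shell D (mnorm alpha)) < bsize D (mnorm alpha))%N.
  by rewrite index_mem.
by exists (Ordinal iS); rewrite nth_index.
Qed.

Variables (mu : complex_measure R D) (L : laurent R D).
Hypothesis mu_qd : quasi_definite mu (fun=> 1).
Hypothesis Lmu_qd : quasi_definite mu (leval L).
Variables S H Sh : simatrix R D.
Hypothesis GSH : gauss_borel (moment_matrix mu (fun=> 1)) S H Sh.

Lemma det_trunc_neq0 (A : simatrix R D) :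
  (forall k, (1 <= k)%N -> \det (trunc A k) != 0) ->
  forall k, \det (trunc A k) != 0.
Proof.
move=> A0 [|k]; last exact: A0.
(* Quasi-definiteness starts at k = 1; for k = 0 the truncation is the empty matrix, and [c] has no
   entries. *)
apply/det_neq0_kerP => c _; apply/matrixP => -[i hi].
by exfalso; rewrite big_ord0 in hi.
Qed.

(* Lam alpha is the value at z^alpha of a linear functional on the Laurent
   polynomials; w below is the vector of conjugated coefficients of the
   polynomial w of the header. *)
Lemma annihilator_trivial k (Lam : 'rV[int]_D -> Cx R) :
  (forall alpha, (mnorm alpha < k)%N ->
    \sum_(gamma <- finsupp L) L gamma * Lam (alpha + gamma) = 0) ->
  (forall l, (k <= l < k + ell L)%N ->
    \sum_(i < l.+1) S l i *m (\col_j Lam (shell D i)`_j) = 0) ->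
  forall alpha, (mnorm alpha < k + ell L)%N -> Lam alpha = 0.
Proof.
move=> LLam SLam; pose G := moment_matrix mu (fun=> 1).
pose y l : 'cV[Cx R]_(bsize D l) := \col_j Lam (shell D l)`_j.
have [w Gw] := trunc_solve y (det_trunc_neq0 mu_qd k).
(* [E] is the defect between [Lam] and the functional given by integration against w; [d l] collects
   its values on [l]. *)
pose E alpha := Lam alpha - \sum_(j < k) \sum_(b < bsize D j)
  moment mu (alpha - (shell D j)`_b) * w j b 0.
pose d l : 'cV[Cx R]_(bsize D l) := \col_j E (shell D l)`_j.
have dE l : d l = y l - \sum_(j < k) G l j *m w j.
  apply/colP => i; rewrite !mxE summxE; congr (_ - _); apply: eq_bigr => j _.
  by rewrite mxE; apply: eq_bigr => b _; rewrite moment_matrix1E.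
have d0 l : (l < k)%N -> d l = 0.
  by move=> lk; have := Gw (Ordinal lk); rewrite dE /= => ->; rewrite subrr.
have S1 : block_lower_unitriangular S by case: GSH.
have dL : forall l, (l < k + ell L)%N -> d l = 0.
  apply: (block_lower_unitriangular_ker S1) => l lk.
  have [{}lk|kl] := ltnP l k.
    by rewrite big1// => i _; rewrite d0 ?mulmx0// (leq_ltn_trans _ lk)// -ltnS.
  (* For l >= k, [S y] vanishes by hypothesis, and row l of [S G] vanishes in the columns j < k, the
     only ones that meet [w]. *)
  under eq_bigr do rewrite dE mulmxBr mulmx_sumr.
  rewrite sumrB SLam ?kl// exchange_big big1 ?subr0//= => j _.
  under eq_bigr do rewrite mulmxA.
  rewrite -mulmx_suml; have := gauss_borel_below GSH (leq_trans (ltn_ord j) kl).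
  by rewrite /simul => ->; rewrite mul0mx.
have E0 alpha : (mnorm alpha < k + ell L)%N -> E alpha = 0.
  move=> /dL /colP; have [i <-] := shellP alpha; rewrite mnorm_shell => /(_ i).
  by rewrite !mxE.
have w0 : forall j, w j = 0.
  apply: (trunc_ker (det_trunc_neq0 Lmu_qd k)) => i; apply/colP => a.
  rewrite mxE summxE; set alpha := (shell D i)`_a.
  have ak : (mnorm alpha < k)%N by rewrite mnorm_shell.
  (* Multiplying z^alpha by L raises the length by at most [ell L], so all the multi-indices
     involved stay where [E] vanishes. *)
  have LE : \sum_(gamma <- finsupp L) L gamma * E (alpha + gamma) = 0.
    rewrite big_seq big1// => gamma gL; rewrite E0 ?mulr0//.
    by apply: leq_ltn_trans (mnormD _ _) _; have := mnorm_ell gL; lia.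
  move: LE; under eq_bigr do rewrite mulrBr.
  rewrite sumrB LLam// sub0r => /eqP; rewrite oppr_eq0 => /eqP LE.
  (* With the [Lam] part gone, what is left is row alpha of the truncated moment matrix of L dmu
     applied to [w]. *)
  rewrite -[RHS]LE; under [RHS]eq_bigr do rewrite mulr_sumr.
  rewrite exchange_big/=; apply: eq_bigr => j _.
  under [RHS]eq_bigr do rewrite mulr_sumr.
  rewrite exchange_big/= mxE; apply: eq_bigr => b _.
  rewrite moment_matrix_levalE mulr_suml; apply: eq_bigr => gamma _.
  by rewrite mulrA.
move=> alpha /E0; rewrite /E big1 ?subr0// => j _.
by rewrite big1// => b _; rewrite w0 mxE mulr0.
Qed.

End annihilator.

(** * Kernels of the sample and Vandermonde matrices, block by block *)

Section nodes_kernel.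
Local Open Scope ring_scope.
Variables (R : realType) (D k m : nat).
Variable p : 'I_(rsize D k m) -> 'rV[Cx R]_D.

Lemma vandermonde_ker (c : 'cV_(rsize D k m)) : laurent_vandermonde p *m c = 0 <->
  forall l, (l < k + m)%N -> \sum_j c j 0 *: chi l (p j) = 0.
Proof.
rewrite /laurent_vandermonde mul_mxcol_cols -mxcol0 -eq_mxcolP.
by split=> h l; [move=> lk; exact: (h (Ordinal lk))|exact: h].
Qed.

Lemma sample_ker (S : simatrix R D) (c : 'cV_(rsize D k m)) :
  sample_matrix p S *m c = 0 <->
  forall l, (k <= l < k + m)%N -> \sum_j c j 0 *: phi S l (p j) = 0.
Proof.
rewrite /sample_matrix (mul_mxcol_cols (fun l j => phi S (k + l) (p j))).
rewrite -mxcol0 -eq_mxcolP.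
split=> h l; last by apply: h; rewrite leq_addr ltn_add2l ltn_ord.
move=> /andP[kl lkm]; have lm : (l - k < m)%N by lia.
by have := h (Ordinal lm); rewrite /= subnKC.
Qed.

(** This is Phi = S chi under the functional f |-> sum_j c_j f(p_j); it links the two kernel
    conditions. *)
Lemma sum_phi (S : simatrix R D) (c : 'cV_(rsize D k m)) l :
  \sum_j c j 0 *: phi S l (p j) =
  \sum_(i < l.+1) S l i *m \sum_j c j 0 *: chi i (p j).
Proof.
under [RHS]eq_bigr do rewrite mulmx_sumr.
rewrite exchange_big; apply: eq_bigr => j _; rewrite /phi scaler_sumr.
by apply: eq_bigr => i _; rewrite -scalemxAr.
Qed.

End nodes_kernel.

Theorem theorem3p3 (R : realType) (D : nat) (hD : (1 <= D)%N)
    (mu : complex_measure R D) (L : laurent R D) (m : nat)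
    (hL : nice L) (hm : ell L = m)
    (hmu : quasi_definite mu (fun=> 1%R))
    (hLmu : quasi_definite mu (leval L))
    (S H Sh : simatrix R D)
    (hSH : gauss_borel (moment_matrix mu (fun=> 1%R)) S H Sh)
    (k : nat) (p : 'I_(rsize D k m) -> 'rV[Cx R]_D)
    (hp : forall j, zero_set L (p j)) :
  poised p S <-> (\rank (laurent_vandermonde p) = rsize D k m).
Proof.
rewrite mxrank_col_kerP /poised det_neq0_kerP; split=> ker c.
  move=> /vandermonde_ker Vc; apply: ker; apply/sample_ker => l /andP[_ lkm].
  rewrite sum_phi big1// => i _; rewrite Vc ?mulmx0//.
  by rewrite (leq_ltn_trans _ lkm)// -ltnS.
move=> /sample_ker Sc; apply: ker; apply/vandermonde_ker => l lkm.
pose Lam alpha : Cx R := (\sum_j c j 0 * mono (p j) alpha)%R.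
have LamE i : (\sum_j c j 0 *: chi i (p j) = \col_b Lam (shell D i)`_b)%R.
  by apply/colP => b; rewrite summxE mxE; apply: eq_bigr => j _; rewrite !mxE.
rewrite LamE; apply/colP => b; rewrite [LHS]mxE [RHS]mxE.
apply: (annihilator_trivial hmu hLmu hSH (k := k)).
- move=> alpha _; under eq_bigr do rewrite mulr_sumr.
  rewrite exchange_big big1//= => j _.
  have [p0 Lp] := hp j.
  (* The nodes have nonzero coordinates, so monomials multiply there and the factor L(p_j) = 0 comes
     out. *)
  transitivity (c j 0 * mono (p j) alpha * leval L (p j))%R.
    rewrite /leval mulr_sumr; apply: eq_bigr => gamma _.
    by rewrite (monoD _ _ p0); ring.
  by rewrite Lp mulr0.
- move=> l'; rewrite hm => lk; rewrite -[RHS](Sc l' lk) sum_phi.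
  by apply: eq_bigr => i _; rewrite LamE.
- by rewrite hm mnorm_shell.
Qed.
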